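(* Let $q\in\mathbb{C}^*$ be not a root of unity, let $z_1,\dots,z_L\neq 0,\infty$ be points such that $q^{\mathbb{Z}}z_m\cap q^{\mathbb{Z}}z_n=\varnothing$ for all $m\neq n$, let $k_1,\dots,k_L$ be nonnegative integers, and put $k=\sum_m k_m$. Let $Z=\mathrm{diag}(\zeta,\zeta^{-1})$ be a diagonal matrix with $\zeta\neq\pm1$. Then there is a one-to-one correspondence between the set of nondegenerate solutions of the $\mathfrak{sl}_2$ XXZ Bethe equations $$\prod_{m=1}^L\frac{w_i-q^{1-k_m}z_m}{w_i-q z_m}=-\zeta^{-2}q^{l_--k}\prod_{j=1}^{l_-}\frac{q w_i-w_j}{w_i-q w_j},\qquad i=1,\dots,l_-,$$ and the set of nondegenerate $Z$-twisted $(\mathrm{SL}(2),q)$-opers with regular singularities at the points $z_1,\dots,z_L\neq 0,\infty$ with weights $k_1,\dots,k_L$.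
   Context: All vector bundles on $\mathbb{P}^1$ are assumed trivializable. For a vector bundle $E$ on $\mathbb{P}^1$, $E^q$ denotes its pullback under $z\mapsto qz$. A (meromorphic) $(\mathrm{SL}(2),q)$-connection is a pair $(E,A)$, where $E$ has rank 2 and $A$ is a meromorphic section of $\mathrm{Hom}_{\mathcal{O}_{\mathbb{P}^1}}(E,E^q)$ with $A(z)$ invertible (in $\mathrm{GL}(2,\mathbb{C}(z))$), such that there is a trivialization in which $A(z)$ has determinant 1. Changing the trivialization by $g(z)$ replaces $A(z)$ by $g(qz)A(z)g(z)^{-1}$ ($q$-gauge change). An $(\mathrm{SL}(2),q)$-oper with regular singularities at $z_1,\dots,z_L\neq0,\infty$ with weights $k_1,\dots,k_L$ is a triple $(E,A,\mathcal{L})$, where $(E,A)$ is a meromorphic $(\mathrm{SL}(2),q)$-connection and $\mathcal{L}\subset E$ is a line subbundle, such that the induced map $\bar A:\mathcal{L}\to(E/\mathcal{L})^q$ is an isomorphism everywhere on $\mathbb{P}^1\setminus\{0,\infty\}$ except at the points $z_m,q^{-1}z_m,\dots,q^{-k_m+1}z_m$ for $m\in\{1,\dots,L\}$, where it has simple zeros. In terms of a section $s(z)$ generating $\mathcal{L}$ over $\mathbb{P}^1\setminus\infty$, this is restated as: $s(qz)\wedge A(z)s(z)$ has simple zeros at $z_m,q^{-1}z_m,\dots,q^{-k_m+1}z_m$ for every $m$ and has no other finite zeros. Such a $q$-oper is called $Z$-twisted if $A$ is $q$-gauge equivalent to $Z^{-1}$. For a $Z$-twisted $q$-oper, choose a trivialization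 in which the $q$-connection matrix is $Z^{-1}$. Then $\mathcal{L}$ is generated over $\mathbb{P}^1\setminus\infty$ by a section $s(z)=(Q_+(z),Q_-(z))^T$, where $Q_\pm$ are polynomials without common roots. After multiplying $s$ by a nonzero constant and performing a constant diagonal gauge change, one may assume that $Q_-(z)=\prod_{i=1}^{l_-}(z-w_i)$ is monic and that $$\zeta^{-1}Q_+(z)Q_-(qz)-\zeta Q_+(qz)Q_-(z)=\rho(z):=\prod_{m=1}^L\prod_{j=0}^{k_m-1}(z-q^{-j}z_m).$$ The $q$-oper is nondegenerate if the $q^{\mathbb{Z}}$-lattices generated by the roots of $\rho$ and of $Q_-$ do not overlap, i.e. $q^{\mathbb{Z}}z_m\cap q^{\mathbb{Z}}w_i=\varnothing$ for all $m$ and $i$. A solution $w_1,\dots,w_{l_-}$ of the Bethe equations is nondegenerate if the $q^{\mathbb{Z}}$-lattices generated by the $w_i$'s and the $z_m$'s are disjoint for all $i$ and $m$.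
   Formalization: Two repairs to a claim that fails as stated: ζ²qⁿ≠1 is assumed for all n≥1 (otherwise the empty Bethe solution has no oper or infinitely many), and a value repeated n times among the w_i must solve its Bethe equation, cleared of denominators, to order n. *)

(* Defs.v *)
From HB Require Import structures.
From mathcomp Require Import all_boot all_order all_algebra.
From mathcomp Require Import fraction.
From mathcomp Require Import reals.
From mathcomp Require Import complex.

Set Implicit Arguments.
Unset Strict Implicit.
Unset Printing Implicit Defensive.

Import GRing.Theory.
Local Open Scope ring_scope.

Notation ratfun C := {fraction {poly C}}.
Local Notation "p %:F" := (tofrac p).

Section RationalFunctions.
Variable C : fieldType.
Implicit Types (f : ratfun C) (p : {poly C}) (a q : C).

Definition regular_at a f : Prop :=
  exists u v : {poly C}, v.[a] != 0 /\ f = u%:F / v%:F.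

Definition regular_at_infty f : Prop :=
  exists u v : {poly C}, [/\ v != 0, (size u <= size v)%N & f = u%:F / v%:F].

Definition regular_on_P1 f : Prop :=
  (forall a, regular_at a f) /\ regular_at_infty f.

Definition vanishes_at a f : Prop :=
  exists u v : {poly C}, [/\ v.[a] != 0, u.[a] = 0 & f = u%:F / v%:F].

(* [has_order a n f]: f = (z - a)^n * (a regular function invertible at a). *)
Definition has_order a (n : nat) f : Prop :=
  exists u v : {poly C},
    [/\ u.[a] != 0, v.[a] != 0 & f = (('X - a%:P) ^+ n * u)%:F / v%:F].

Definition dilate q p : {poly C} := p \Po (q *: 'X).

(* The pullback f(z) |-> f(qz); for q != 0 it does not depend on the chosen
   numerator and denominator, see [qpull_div]. *)
Definition qpull q f : ratfun C :=
  (dilate q (frac (repr f)).1)%:F / (dilate q (frac (repr f)).2)%:F.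

Lemma dilate_eq0 q p : q != 0 -> (dilate q p == 0) = (p == 0).
Proof.
move=> q0; apply/idP/idP => [|/eqP->]; last by rewrite /dilate comp_poly0.
have sz : size (q *: 'X : {poly C}) = 2%N by rewrite size_scale // size_polyX.
by rewrite /dilate -!size_poly_eq0 size_comp_poly2.
Qed.

Lemma qpull_div q (u v : {poly C}) : q != 0 -> v != 0 ->
  qpull q (u%:F / v%:F) = (dilate q u)%:F / (dilate q v)%:F.
Proof.
move=> q0 v0; rewrite /qpull; set r := repr _.
have r0 : (frac r).2 != 0 := denom_ratioP r.
have piE : u%:F / v%:F = (frac r).1%:F / (frac r).2%:F.
  have frE (x : {ratio {poly C}}) :
      (\pi_(ratfun C) x)%qT * (frac x).2%:F = (frac x).1%:F.
    unlock tofrac; rewrite -[LHS]FracField.pi_mul.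
    apply/eqP; rewrite FracField.equivf_def /FracField.mulf.
    by rewrite !numden_Ratio ?mulr1 ?oner_neq0 ?denom_ratioP // mulrC.
  by rewrite -frE /r reprK mulfK // tofrac_eq0.
move/eqP: piE; rewrite eqr_div ?tofrac_eq0 // -!tofracM tofrac_eq => /eqP E.
apply/eqP; rewrite eqr_div ?tofrac_eq0 ?dilate_eq0 // -!tofracM tofrac_eq.
by rewrite /dilate -!comp_polyM E.
Qed.

End RationalFunctions.

Section Opers.
Variable C : fieldType.
Implicit Types (q zeta : C) (w : seq C).

Notation K := (ratfun C).

(* A change of trivialization of a trivializable rank 2 bundle on P^1: an
   automorphism of O^2 over all of P^1. *)
Definition triv_change (g : 'M[K]_2) : Prop :=
  [/\ g \in unitmx,
      forall i j, regular_on_P1 (g i j) &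
      forall i j, regular_on_P1 (invmx g i j)].

Definition gauge q (g A : 'M[K]_2) : 'M[K]_2 :=
  map_mx (qpull q) g *m A *m invmx g.

(* A triple (E, A, L) read in a global trivialization of E.  A line subbundle
   of O^2 is recorded by its generic fibre, a line of C(z)^2; this loses
   nothing, since a subbundle is the saturation of its generic fibre. *)
Record oper_data := OperData {
  conn : 'M[K]_2;
  line : {vspace 'cV[K]_2}
}.

Definition transport (g : 'M[K]_2) (V : {vspace 'cV[K]_2}) :
    {vspace 'cV[K]_2} :=
  (linfun (mulmx g) @: V)%VS.

Definition change_triv q g (O : oper_data) : oper_data :=
  OperData (gauge q g (conn O)) (transport g (line O)).

Definition oper_iso q (O O' : oper_data) : Prop :=
  exists2 g, triv_change g & O' = change_triv q g O.

Definition SL2_connection q (A : 'M[K]_2) : Prop :=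
  A \in unitmx /\ exists2 g, triv_change g & \det (gauge q g A) = 1.

Definition section (Qp Qm : {poly C}) : 'cV[K]_2 :=
  \col_i (if i == 0 then Qp else Qm)%:F.

(* (Qp, Qm)^T is a nowhere vanishing section of V over P^1 minus infinity,
   i.e. generates the corresponding subbundle there. *)
Definition generates (Qp Qm : {poly C}) (V : {vspace 'cV[K]_2}) : Prop :=
  coprimep Qp Qm /\ V = <[section Qp Qm]>%VS.

Definition wedge (u v : 'cV[K]_2) : K := \det (row_mx u v : 'M_(1 + 1)).

Definition singular_point q (L : nat) (z : 'I_L -> C) (k : 'I_L -> nat)
    (a : C) : Prop :=
  exists m : 'I_L, exists2 j : nat, (j < k m)%N & a = q ^- j * z m.

(* The induced map L -> (E/L)^q is s(qz) /\ A(z)s(z) in terms of a generator s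
   of L over P^1 minus infinity.  It is an isomorphism on P^1 minus {0, oo}
   off the singular points, where it has simple zeros, and moreover it does
   not vanish at the finite point 0. *)
Definition regular_singularities q (L : nat) (z : 'I_L -> C)
    (k : 'I_L -> nat) (O : oper_data) : Prop :=
  exists Qp Qm : {poly C}, generates Qp Qm (line O) /\
    let s := section Qp Qm in
    let f := wedge (map_mx (qpull q) s) (conn O *m s) in
    [/\ forall a, singular_point q z k a -> has_order a 1 f,
        forall a, a != 0 -> ~ singular_point q z k a -> has_order a 0 f &
        ~ vanishes_at 0 f].

Definition SL2_oper q (L : nat) (z : 'I_L -> C) (k : 'I_L -> nat)
    (O : oper_data) : Prop :=
  [/\ SL2_connection q (conn O), (\dim (line O) = 1)%N
    & regular_singularities q z k O].

Definition twist zeta : 'M[C]_2 :=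
  diag_mx (\row_i (if i == 0 then zeta else zeta^-1)).

Definition constmx (M : 'M[C]_2) : 'M[K]_2 := map_mx (fun c : C => c%:P%:F) M.

Definition trivializes_to_twist q zeta (O : oper_data) (g : 'M[K]_2) : Prop :=
  triv_change g /\ gauge q g (conn O) = constmx (invmx (twist zeta)).

Definition twisted q zeta (O : oper_data) : Prop :=
  exists g, trivializes_to_twist q zeta O g.

Definition disjoint_lattices q (x y : C) : Prop :=
  forall a b : int, q ^ a * x <> q ^ b * y.

Definition nondegenerate_oper q zeta (L : nat) (z : 'I_L -> C)
    (O : oper_data) : Prop :=
  forall g Qp Qm, trivializes_to_twist q zeta O g ->
    generates Qp Qm (transport g (line O)) ->
  forall (m : 'I_L) (a : C), root Qm a -> disjoint_lattices q (z m) a.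

Definition nondegenerate_twisted_oper q zeta (L : nat) (z : 'I_L -> C)
    (k : 'I_L -> nat) (O : oper_data) : Prop :=
  [/\ SL2_oper q z k O, twisted q zeta O & nondegenerate_oper q zeta z O].

Definition rho q (L : nat) (z : 'I_L -> C) (k : 'I_L -> nat) : {poly C} :=
  \prod_(m < L) \prod_(j < k m) ('X - (q ^- j * z m)%:P).

Definition roots_poly w : {poly C} := \prod_(a <- w) ('X - a%:P).

Definition corresponds q zeta (L : nat) (z : 'I_L -> C) (k : 'I_L -> nat)
    (O : oper_data) w : Prop :=
  exists (g : 'M[K]_2) (Qp : {poly C}),
    let Qm := roots_poly w in
    [/\ trivializes_to_twist q zeta O g,
        generates Qp Qm (transport g (line O)) &
        zeta^-1 *: (Qp * dilate q Qm) - zeta *: (dilate q Qp * Qm)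
          = rho q z k].

End Opers.

Section Bethe.
Variable C : fieldType.
Variables (q zeta : C) (L : nat) (z : 'I_L -> C) (k : 'I_L -> nat).
Implicit Types w : seq C.

Definition total_weight : nat := \sum_(m < L) k m.

Definition bethe_coef w : C :=
  zeta ^- 2 * q ^ ((size w)%:Z - total_weight%:Z).

(* Since division is total, the denominators are required to be nonzero. *)
Definition bethe_equations w : Prop :=
  forall x, x \in w ->
  [/\ forall m : 'I_L, x - q * z m != 0,
      forall y, y \in w -> x - q * y != 0 &
      \prod_(m < L) ((x - q ^ (1 - (k m)%:Z) * z m) / (x - q * z m))
      = - bethe_coef w * \prod_(y <- w) ((q * x - y) / (x - q * y))].

(* The difference of the two sides of the Bethe equation as a function of x,
   multiplied by the denominators. *)
Definition bethe_poly w : {poly C} :=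
  \prod_(m < L) ('X - (q ^ (1 - (k m)%:Z) * z m)%:P)
    * \prod_(y <- w) ('X - (q * y)%:P)
  + bethe_coef w *: (\prod_(y <- w) (q *: 'X - y%:P)
                      * \prod_(m < L) ('X - (q * z m)%:P)).

(* When x occurs n times in w, the n coinciding Bethe equations at x stand for
   vanishing to order n at x.  For pairwise distinct entries this is void. *)
Definition bethe_multiplicities w : Prop :=
  forall x, (1 < count_mem x w)%N ->
    ('X - x%:P) ^+ (count_mem x w) %| bethe_poly w.

Definition nondegenerate_bethe_solution w : Prop :=
  [/\ bethe_equations w, bethe_multiplicities w &
      forall (m : 'I_L) x, x \in w -> disjoint_lattices q (z m) x].

End Bethe.

(* R induces a bijection from PA / eA to PB / eB. *)
Definition one_to_one_correspondence (A B : Type)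
    (PA : A -> Prop) (eA : A -> A -> Prop)
    (PB : B -> Prop) (eB : B -> B -> Prop) (R : A -> B -> Prop) : Prop :=
  [/\ forall a, PA a -> exists2 b, PB b & R a b,
      forall b, PB b -> exists2 a, PA a & R a b &
      forall a a' b b', PA a -> PA a' -> PB b -> PB b' ->
        R a b -> R a' b' -> (eA a a' <-> eB b b')].

(* Main.v *)
Require Import Defs.
From mathcomp Require Import all_boot all_order all_algebra.
From mathcomp Require Import fraction reals complex.
From mathcomp Require Import ring.
Import GRing.Theory.
Local Open Scope ring_scope.
Set Implicit Arguments.
Unset Strict Implicit.
Unset Printing Implicit Defensive.

(** Both sides are governed by the quantum Wronskian equation
      zeta^-1 Q+(z) Q-(qz) - zeta Q+(qz) Q-(z) = rho(z).

    From opers to this equation.  A function regular on all of P^1 is a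
    constant, so a change of trivialization is an element of GL_2(C), and two
    trivializations in which the connection is Z^-1 differ by a matrix commuting
    with Z, hence (zeta^2 != 1) by a diagonal one.  In such a trivialization the
    line is spanned by a coprime pair (Q+, Q-), unique up to rescaling each of
    Q+ and Q-, and the induced map of the line to the quotient is minus the
    quantum Wronskian of the pair.  It is a polynomial with the same zeros and
    multiplicities as rho, hence a multiple of rho
    ([has_singularities_rho], [regular_singularities_twist]), and the rescaling
    makes it equal to rho with Q- monic.  So an oper up to isomorphism is a
    solution (Q+, Q-) of the equation with Q- monic
    ([twisted_section_unique], [corresponds_iso]).

    From this equation to the Bethe equations.  Fix Q- with roots w.  A
    common zero of Q+(z) and Q-(z), or of Q-(z) and Q-(qz), would be a zero of rho,
    which nondegeneracy excludes ([wronskian_rho_coprimep]); so Q-(z) and Q-(qz) are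
    coprime.  Reading the equation modulo Q-(z), and its
    pullback under z |-> z/q modulo Q-(z), gives two expressions for Q+ modulo
    Q-; they agree exactly when Q- divides
      zeta rho(z) Q-(z/q) + zeta^-1 rho(z/q) Q-(qz),
    called [crossing] below.  If they do, the Chinese remainder theorem gives
    Q+ modulo Q- with an error Q-(z) Q-(qz) R(z), and the error is removed by
    adding E Q- to Q+, where zeta^-1 E(z) - zeta E(qz) = R(z).  This last
    equation is diagonal on monomials, with eigenvalues zeta^-1 - zeta q^n, which
    do not vanish since zeta^2 q^n != 1; the same fact makes Q+ unique
    ([wronskian_surj], [wronskian_injl]).  Finally rho(z) / rho(z/q) telescopes, up to
    a power of q, to the left side of the Bethe equations, so that, up to factors which do not
    vanish on nondegenerate roots, [crossing] is the Bethe polynomial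
    ([crossing_bethe]).  Divisibility of the latter by Q- is the Bethe equations
    at the simple roots and the multiplicity condition at the others
    ([bethe_wronskian]). *)

Local Notation "p %:F" := (tofrac p).

(** * Global changes of trivialization are constant matrices *)

Section Constants.
Variable C : closedFieldType.
Local Notation K := (ratfun C).
Implicit Types (c a q zeta : C) (P Q : {poly C}) (M N : 'M[C]_2).

Lemma frac_eqE (u v u' v' : {poly C}) : v != 0 -> v' != 0 ->
  (u%:F / v%:F = u'%:F / v'%:F) <-> (u * v' = u' * v).
Proof.
move=> v0 v'0; split=> [/eqP|E]; last apply/eqP.
  by rewrite eqr_div ?tofrac_eq0 // -!tofracM tofrac_eq => /eqP.
by rewrite eqr_div ?tofrac_eq0 // -!tofracM tofrac_eq E.
Qed.

Lemma polyF_div P : P%:F = P%:F / (1 : {poly C})%:F :> K.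
Proof. by rewrite tofrac1 divr1. Qed.

Lemma polyF_eqE P (u v : {poly C}) : v != 0 ->
  (P%:F = u%:F / v%:F :> K) <-> (P * v = u).
Proof. by move=> v0; rewrite polyF_div frac_eqE ?oner_neq0 // mulr1. Qed.

Lemma horner_neq0 P a : P.[a] != 0 -> P != 0.
Proof. by apply: contraNneq => ->; rewrite horner0. Qed.

(** In lowest terms, a denominator without roots is constant over an
    algebraically closed field, and regularity at infinity then bounds the degree
    of the numerator by 0. *)
Lemma regular_on_P1_const (f : K) :
  regular_on_P1 f <-> exists c, f = c%:P%:F.
Proof.
split=> [[freg [u [v [v0 suv fE]]]]|[c ->]]; last first.
  split=> [a|]; first by exists c%:P, 1; rewrite hornerC oner_neq0 -polyF_div.
  exists c%:P, 1; split; rewrite -?polyF_div ?oner_neq0 // size_poly1.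
  exact: size_polyC_leq1.
have [p [r [r0 cpr fpr]]] :
    exists p r : {poly C}, [/\ r != 0, coprimep p r & f = p%:F / r%:F].
  pose d := gcdp u v.
  have d0 : d != 0 by rewrite gcdp_eq0 negb_and v0 orbT.
  have dv := divpK (dvdp_gcdr u v); have du := divpK (dvdp_gcdl u v).
  exists (u %/ d), (v %/ d).
  have vd0 : v %/ d != 0 by apply: contraNneq v0 => vd0; rewrite -dv vd0 mul0r.
  split => //; first by rewrite coprimep_div_gcd // v0 orbT.
  by rewrite fE; apply/(frac_eqE _ _ v0 vd0); rewrite -[in LHS]du -[in RHS]dv; ring.
have rroot a : ~~ root r a.
  have [u' [v' [v'a fE']]] := freg a.
  apply/negP => ra; have v'0 := horner_neq0 v'a.
  move: fE'; rewrite fpr => /(frac_eqE _ _ r0 v'0) /(congr1 (horner^~ a)).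
  rewrite !hornerM (eqP ra) mulr0 => /eqP; rewrite mulf_eq0 (negPf v'a) orbF.
  move: cpr; rewrite coprimep_sym => cpr.
  by rewrite (negPf (coprimep_root cpr ra)).
have /size_poly1P[c c0 rE] : size r == 1.
  by apply/negP => /negP/closed_rootP[x]; apply/negP.
have vp : p * v = u * r by apply/(frac_eqE _ _ r0 v0); rewrite -fpr.
have sp : (size p <= 1)%N.
  have [->|p0] := eqVneq p 0; first by rewrite size_poly0.
  have := congr1 (size : {poly C} -> nat) vp.
  rewrite size_mul // rE mulrC mul_polyC size_scale // => spv.
  by move: suv; rewrite -spv -ltnS; case: (size v) (size_poly_eq0 v) v0 => [<-|s _ _];
     rewrite // addnS /= ltnS -[X in (_ <= X)%N]add1n leq_add2r.
exists (p`_0 / c); rewrite fpr; apply/esym/polyF_eqE => //.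
by rewrite rE -polyCM divfK // -size1_polyC.
Qed.

Lemma constmxE M i j : constmx M i j = (M i j)%:P%:F.
Proof. by rewrite mxE. Qed.

Lemma constmx_map M : constmx M = map_mx (@tofrac _ \o @polyC C) M.
Proof. by []. Qed.

Lemma constmxM M N : constmx (M *m N) = constmx M *m constmx N.
Proof. by rewrite !constmx_map map_mxM. Qed.

Lemma constmx1 : constmx (1%:M : 'M[C]_2) = 1%:M.
Proof. by rewrite constmx_map map_mx1. Qed.

Lemma constmxV M : constmx (invmx M) = invmx (constmx M).
Proof. by rewrite !constmx_map map_invmx. Qed.

Lemma constmx_unit M : (constmx M \in unitmx) = (M \in unitmx).
Proof. by rewrite constmx_map map_unitmx. Qed.

Lemma constmx_inj : injective (@constmx C).
Proof.
move=> M N /matrixP E; apply/matrixP => i j.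
by move: (E i j); rewrite !constmxE => /eqP; rewrite tofrac_eq => /eqP/polyC_inj.
Qed.

Lemma det_constmx M : \det (constmx M) = (\det M)%:P%:F.
Proof. by rewrite constmx_map det_map_mx. Qed.

Lemma triv_changeP (g : 'M[K]_2) :
  triv_change g <-> exists2 M, M \in unitmx & g = constmx M.
Proof.
split=> [[gU greg _]|[M MU ->]].
  have ex i j : exists c, g i j = c%:P%:F by apply/regular_on_P1_const.
  have [f fE] := fin_all_exists (fun i => fin_all_exists (ex i)).
  have gE : g = constmx (\matrix_(i, j) f i j).
    by apply/matrixP => i j; rewrite constmxE mxE.
  by exists (\matrix_(i, j) f i j); rewrite // -constmx_unit -gE.
split; rewrite ?constmx_unit // => i j; apply/regular_on_P1_const.
  by exists (M i j); rewrite constmxE.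
by exists (invmx M i j); rewrite -constmxV constmxE.
Qed.

Lemma qpull_poly q P : q != 0 -> qpull q P%:F = (dilate q P)%:F.
Proof.
move=> q0; rewrite [in LHS]polyF_div qpull_div ?oner_neq0 //.
by rewrite /dilate comp_polyC -polyF_div.
Qed.

Lemma gauge_constmx q M (A : 'M[K]_2) : q != 0 ->
  gauge q (constmx M) A = constmx M *m A *m constmx (invmx M).
Proof.
move=> q0; rewrite /gauge constmxV; congr (_ *m _ *m _).
by apply/matrixP => i j; rewrite !mxE qpull_poly // /dilate comp_polyC.
Qed.

Lemma transportM (g h : 'M[K]_2) V :
  transport g (transport h V) = transport (g *m h) V.
Proof.
rewrite /transport -limg_comp; congr (_ @: _)%VS; apply/lfunP => v.
by rewrite comp_lfunE !lfunE /= mulmxA.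
Qed.

Lemma transport1 (V : {vspace 'cV[K]_2}) : transport 1%:M V = V.
Proof.
rewrite /transport -[RHS]lim1g; congr (_ @: _)%VS; apply/lfunP => v.
by rewrite !lfunE /= mul1mx.
Qed.

Definition rowcomb M (i : 'I_2) P Q : {poly C} := M i 0 *: P + M i 1 *: Q.

Lemma constmx_section M P Q :
  constmx M *m section P Q = section (rowcomb M 0 P Q) (rowcomb M 1 P Q).
Proof.
apply/matrixP => i j; rewrite !mxE 2!big_ord_recl big_ord0 !mxE /= addr0.
rewrite (_ : lift _ _ = 1); last exact/val_inj.
rewrite -!tofracM -tofracD /rowcomb -!mul_polyC.
by case: (unliftP 0 i) => [k ->|->] //=; rewrite ord1 (_ : lift _ _ = 1) //; exact/val_inj.
Qed.

Lemma transport_section (g : 'M[K]_2) v : transport g <[v]>%VS = <[g *m v]>%VS.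
Proof. by rewrite /transport limg_line lfunE. Qed.

Lemma det2E (S : comRingType) (M : 'M[S]_2) :
  \det M = M 0 0 * M 1 1 - M 0 1 * M 1 0.
Proof.
rewrite (expand_det_row _ 0) !big_ord_recl big_ord0 /cofactor !det_mx11 !mxE /=.
have l0 : lift 0 0 = 1 :> 'I_2 by exact/val_inj.
have l1 : lift 1 0 = 0 :> 'I_2 by exact/val_inj.
by rewrite ?l0 ?l1 addn0 add0n expr0 expr1; ring.
Qed.

(** A common root of the two combinations is, by Cramer's rule, a common root of
    P and Q. *)
Lemma coprimep_rowcomb M P Q : M \in unitmx ->
  coprimep P Q -> coprimep (rowcomb M 0 P Q) (rowcomb M 1 P Q).
Proof.
rewrite unitmxE unitfE det2E => dM cPQ.
apply/Pdiv.ClosedField.coprimepP => a /eqP r0; apply/negP => /eqP r1.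
move: r0 r1; rewrite /rowcomb !hornerE => r0 r1.
have Pa : P.[a] = 0.
  apply: (mulfI dM); rewrite mulr0.
  transitivity (M 1 1 * (M 0 0 * P.[a] + M 0 1 * Q.[a])
     - M 0 1 * (M 1 0 * P.[a] + M 1 1 * Q.[a])); first by ring.
  by rewrite r0 r1; ring.
have Qa : Q.[a] = 0.
  apply: (mulfI dM); rewrite mulr0.
  transitivity (M 0 0 * (M 1 0 * P.[a] + M 1 1 * Q.[a])
     - M 1 0 * (M 0 0 * P.[a] + M 0 1 * Q.[a])); first by ring.
  by rewrite r0 r1; ring.
by have := coprimep_root cPQ (introT eqP Pa); rewrite Qa eqxx.
Qed.

Lemma generates_transport M P Q V : M \in unitmx -> generates P Q V ->
  generates (rowcomb M 0 P Q) (rowcomb M 1 P Q) (transport (constmx M) V).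
Proof.
move=> MU [cPQ ->]; split; first exact: coprimep_rowcomb.
by rewrite transport_section constmx_section.
Qed.

Lemma section_entries P Q : (section P Q 0 0 = P%:F) * (section P Q 1 0 = Q%:F).
Proof. by split; rewrite mxE. Qed.

Lemma section_neq0 P Q : coprimep P Q -> section P Q != 0.
Proof.
move=> cPQ; apply/eqP => /matrixP s0.
have := s0 0 0; have := s0 1 0; rewrite !section_entries !mxE => /eqP Q0 /eqP P0.
move: Q0 P0; rewrite !tofrac_eq0 => /eqP Q0 /eqP P0.
by move: cPQ; rewrite P0 Q0 coprimep0 eqp01.
Qed.

(** The factor of proportionality is a priori a rational function; a Bezout
    relation for P and Q shows that it is a polynomial e, which divides the coprime
    pair P', Q' and so is a constant. *)
Lemma generates_unique P Q P' Q' V : generates P Q V -> generates P' Q' V ->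
  exists c, [/\ c != 0, P' = c *: P & Q' = c *: Q].
Proof.
move=> [cPQ VE] [cPQ' VE'].
have cross : P' * Q = Q' * P.
  have : section P' Q' \in <[section P Q]>%VS by rewrite -VE VE' memv_line.
  move=> /vlineP[t sE]; apply/eqP; rewrite -tofrac_eq !tofracM.
  have := congr1 (fun s : 'cV[K]_2 => s 0 0) sE.
  have := congr1 (fun s : 'cV[K]_2 => s 1 0) sE.
  by rewrite /= ![(_ *: _ : 'cV[K]_2) _ _]mxE !section_entries => -> ->; apply/eqP; ring.
have [[a b] /= ab] := Bezout_eq1_coprimepP _ _ cPQ.
pose e := a * P' + b * Q'.
have P'E : P' = e * P.
  by rewrite -[LHS]mulr1 -ab mulrDr [P' * (b * Q)]mulrCA cross /e; ring.
have Q'E : Q' = e * Q.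
  by rewrite -[LHS]mulr1 -ab mulrDr [Q' * (a * P)]mulrCA -cross /e; ring.
have : e %| 1.
  apply: (@dvdp_trans _ (gcdp P' Q')); last by rewrite dvdp1.
  by rewrite dvdp_gcd P'E Q'E !dvdp_mulr.
rewrite dvdp1 => /size_poly1P[c c0 eE]; exists c; split=> //.
  by rewrite P'E eE mul_polyC.
by rewrite Q'E eE mul_polyC.
Qed.

Lemma wedgeE (u v : 'cV[K]_2) : wedge u v = u 0 0 * v 1 0 - v 0 0 * u 1 0.
Proof.
have uE i : (row_mx u v : 'M_(1 + 1)) i (0 : 'I_2) = u i 0.
  by rewrite -(row_mxEl u v); congr (row_mx _ _ _ _); exact/val_inj.
have vE i : (row_mx u v : 'M_(1 + 1)) i (1 : 'I_2) = v i 0.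
  by rewrite -(row_mxEr u v); congr (row_mx _ _ _ _); exact/val_inj.
by rewrite /wedge det2E !uE !vE.
Qed.

End Constants.

(** * Orders of vanishing and the polynomial rho *)

Section Orders.
Variable C : closedFieldType.
Local Notation K := (ratfun C).
Implicit Types (c a q zeta : C) (P Q F : {poly C}).

Lemma has_order_polyP a n F :
  has_order a n (F%:F : K) <-> F != 0 /\ mup a F = n.
Proof.
split=> [[u [v [ua va]]]|[F0 muF]].
  have v0 := horner_neq0 va; have u0 := horner_neq0 ua.
  move=> /(polyF_eqE _ _ v0) FvE.
  have X0 : ('X - a%:P) ^+ n != 0 :> {poly C} by rewrite expf_neq0 // polyXsubC_eq0.
  have F0 : F != 0.
    by apply: contraNneq (mulf_neq0 X0 u0) => F0; rewrite -FvE F0 mul0r.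
  split=> //; rewrite -(@mupMl _ a F v) // FvE mupMl // mup_XsubCX eqxx //.
have := mup_geq a n F0; rewrite -{1}muF leqnn => /esym/dvdpP[u FE].
have := mup_geq a n.+1 F0; rewrite -{1}muF ltnn => /esym/negbT ndv.
exists u, 1; rewrite hornerC oner_neq0 -polyF_div; split=> //; last by rewrite FE mulrC.
apply: contra ndv => ua; have : root u a by [].
by rewrite -dvdp_XsubCl FE exprS => ?; rewrite dvdp_mul.
Qed.

Lemma vanishes_at_polyP a F : vanishes_at a (F%:F : K) <-> root F a.
Proof.
split=> [[u [v [va ua]]]|ra]; last first.
  by exists F, 1; rewrite hornerC oner_neq0 -polyF_div (eqP ra).
move=> /(polyF_eqE _ _ (horner_neq0 va)) /(congr1 (horner^~ a)).
by rewrite hornerM ua => /eqP; rewrite mulf_eq0 (negPf va) orbF.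
Qed.

Lemma vanishes_atZ a c (f : K) : vanishes_at a f -> vanishes_at a (c%:P%:F * f).
Proof.
move=> [u [v [va ua ->]]]; exists (c%:P * u), v.
by rewrite hornerM ua mulr0 tofracM mulrA.
Qed.

Lemma has_orderZ a n c (f : K) : c != 0 ->
  has_order a n f -> has_order a n (c%:P%:F * f).
Proof.
move=> c0 [u [v [ua va ->]]]; exists (c%:P * u), v.
rewrite hornerM hornerC mulf_neq0 //; split=> //.
by rewrite mulrA -tofracM mulrCA.
Qed.

(** Both polynomials split into linear factors. *)
Lemma eq_mup_proportional F G : F != 0 -> G != 0 ->
  (forall a, mup a F = mup a G) -> exists2 c, c != 0 & F = c *: G.
Proof.
move=> F0 G0 E.
have [r FE] := closed_field_poly_normal F; have [s GE] := closed_field_poly_normal G.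
have lF : lead_coef F != 0 by rewrite lead_coef_eq0.
have lG : lead_coef G != 0 by rewrite lead_coef_eq0.
have mupZ c P a : c != 0 -> mup a (c *: P) = mup a P.
  by move=> c0; rewrite -mul_polyC mupMr // rootC.
exists (lead_coef F / lead_coef G); first by rewrite mulf_neq0 ?invr_eq0.
rewrite [X in _ = _ *: X]GE scalerA divfK // {1}FE; congr (_ *: _).
apply: perm_big; apply/allP => a _ /=.
by rewrite -!mu_prod_XsubC -(mupZ _ _ _ lF) -FE -[X in _ == X](mupZ _ _ _ lG) -GE E.
Qed.

End Orders.

Section Rho.
Variable C : closedFieldType.
Local Notation K := (ratfun C).
Variables (q : C) (L : nat) (z : 'I_L -> C) (k : 'I_L -> nat).
Hypothesis q0 : q != 0.
Implicit Types (a x : C).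

(** A list and not a set, so that rho is the product over it whatever q and z;
    that it has no repetition ([singular_points_uniq]) is why rho has simple
    zeros. *)
Definition singular_points : seq C :=
  [seq q ^- j * z m | m <- enum 'I_L, j <- iota 0 (k m)].

Lemma mem_singular_points a : a \in singular_points <-> singular_point q z k a.
Proof.
split=> [/allpairsPdep[m [j [_ jk ->]]]|[m [j jk ->]]].
  by exists m; exists j => //; rewrite mem_iota in jk.
by apply/allpairsPdep; exists m, j; rewrite mem_enum mem_iota.
Qed.

Lemma rho_roots : rho q z k = \prod_(a <- singular_points) ('X - a%:P).
Proof.
rewrite /rho /singular_points big_allpairs_dep big_enum /=.
apply: eq_bigr => m _.
by rewrite -(big_mkord xpredT (fun j => 'X - (q ^- j * z m)%:P)) /index_iota subn0.
Qed.

Lemma rho_neq0 : rho q z k != 0.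
Proof. by rewrite rho_roots prodf_seq_neq0; apply/allP => a _; rewrite polyXsubC_eq0. Qed.

Lemma root_rhoP a : reflect (singular_point q z k a) (root (rho q z k) a).
Proof.
rewrite rho_roots root_prod_XsubC.
by apply: (iffP idP) => /mem_singular_points.
Qed.

Lemma disjoint_lattices_exp (x y : C) (i j : nat) : disjoint_lattices q x y ->
  q ^- i * x != q ^- j * y.
Proof. by move=> d; apply/eqP; have := d (- i%:Z) (- j%:Z); rewrite !exprnN. Qed.

Lemma root_rho_disjoint a : (forall m, disjoint_lattices q (z m) a) ->
  ~~ root (rho q z k) a.
Proof.
move=> d; apply/root_rhoP => -[m [j _ aE]].
by have := disjoint_lattices_exp j 0 (d m); rewrite -aE expr0 invr1 mul1r eqxx.
Qed.

Hypothesis qn1 : forall n : nat, (0 < n)%N -> q ^+ n != 1.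

Lemma expq_inj : injective (fun n : nat => q ^+ n).
Proof.
have H i j : (i < j)%N -> q ^+ i != q ^+ j.
  move=> ij; have := @qn1 (j - i); rewrite subn_gt0 => /(_ ij); apply: contraNneq => E.
  apply/eqP/(mulIf (expf_neq0 i q0)); rewrite mul1r -exprD subnK ?E //.
  exact: ltnW.
move=> i j E; apply/eqP; case: ltngtP => // /H; rewrite E eqxx //.
Qed.

Hypothesis z0 : forall m, z m != 0.
Hypothesis zdisj : forall m n, m != n -> disjoint_lattices q (z m) (z n).

(** Points of different strings lie in disjoint lattices; points of one string
    differ because z m is nonzero and q is not a root of unity. *)
Lemma singular_points_uniq : uniq singular_points.
Proof.
apply: allpairs_uniq_dep => [|m _|]; rewrite ?enum_uniq ?iota_uniq //.
move=> [m i] [n j] _ _ /= E.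
have mn : m = n.
  apply/eqP; apply: contraT => mn.
  by have := disjoint_lattices_exp i j (zdisj mn); rewrite E eqxx.
case: _ / mn j E => j /(mulIf (z0 m)) /invr_inj /expq_inj -> //.
Qed.

Lemma mup_rho a : mup a (rho q z k) = root (rho q z k) a.
Proof.
by rewrite rho_roots root_prod_XsubC mu_prod_XsubC (count_uniq_mem _ singular_points_uniq).
Qed.

Lemma rho0N : ~~ root (rho q z k) 0.
Proof.
apply/root_rhoP => -[m [j _ /esym/eqP]].
by rewrite mulf_eq0 invr_eq0 expf_eq0 (negPf q0) (negPf (z0 _)) andbF.
Qed.

(** The zero pattern imposed by [regular_singularities] on the induced map,
    isolated here because it does not depend on the choice of trivialization. *)
Definition has_singularities (f : K) : Prop :=
  [/\ forall a, singular_point q z k a -> has_order a 1 f,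
      forall a, a != 0 -> ~ singular_point q z k a -> has_order a 0 f &
      ~ vanishes_at 0 f].

Lemma has_singularitiesZ c (f : K) : c != 0 ->
  has_singularities f -> has_singularities (c%:P%:F * f).
Proof.
move=> c0 [f1 f2 f3]; split=> [a /f1|a a0 /(f2 a a0)|]; try exact: has_orderZ.
move=> /(vanishes_atZ c^-1); rewrite mulrA -tofracM -polyCM mulVf //.
by rewrite tofrac1 mul1r.
Qed.

(** The conditions fix the multiplicity of F at every point, the origin
    included, and rho has the same multiplicities. *)
Lemma has_singularities_rho (F : {poly C}) :
  has_singularities F%:F <-> exists2 c, c != 0 & F = c *: rho q z k.
Proof.
split=> [[f1 f2 f3]|[c c0 ->]].
  have r0 : ~~ root F 0 by apply/negP => /vanishes_at_polyP.
  have F0 : F != 0 by apply: contraNneq r0 => ->; rewrite root0.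
  apply: eq_mup_proportional rho_neq0 _ => // a; rewrite mup_rho.
  have [/root_rhoP|/root_rhoP] := boolP (root _ a).
    by move=> /f1/has_order_polyP[].
  have [->|a0] := eqVneq a 0; first by rewrite mupNroot.
  by move=> /(f2 a a0)/has_order_polyP[].
rewrite -mul_polyC tofracM; apply: has_singularitiesZ c0 _.
split=> [a /root_rhoP|a a0 /root_rhoP|]; last first.
- by move/vanishes_at_polyP; apply/negP/rho0N.
- by move=> r; apply/has_order_polyP; rewrite rho_neq0 mup_rho (negPf r).
- by move=> r; apply/has_order_polyP; rewrite rho_neq0 mup_rho r.
Qed.

End Rho.

(** * The quantum Wronskian equation *)

Section Dilation.
Variable C : fieldType.
Implicit Types (q a : C) (P Q : {poly C}).

Lemma horner_dilate q P a : (dilate q P).[a] = P.[q * a].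
Proof. by rewrite /dilate horner_comp !hornerE. Qed.

Lemma dilateM q P Q : dilate q (P * Q) = dilate q P * dilate q Q.
Proof. exact: comp_polyM. Qed.

Lemma dilateB q P Q : dilate q (P - Q) = dilate q P - dilate q Q.
Proof. exact: comp_polyB. Qed.

Lemma dilateZ q a P : dilate q (a *: P) = a *: dilate q P.
Proof. exact: comp_polyZ. Qed.

Lemma coef_dilate q P n : (dilate q P)`_n = q ^+ n * P`_n.
Proof.
rewrite /dilate comp_polyE coef_sum.
have [nP|nP] := ltnP n (size P).
  rewrite (bigD1 (Ordinal nP)) //= big1 => [|i ni].
    by rewrite exprZn !coefZ coefXn eqxx mulr1 addr0 mulrC.
  rewrite -val_eqE /= in ni.
  by rewrite exprZn !coefZ coefXn eq_sym (negPf ni) !mulr0.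
rewrite [P`_n]nth_default // mulr0 big1 // => i _.
by rewrite exprZn !coefZ coefXn gtn_eqF ?mulr0 // (leq_trans _ nP).
Qed.

Lemma dilateVK q P : q != 0 -> dilate q^-1 (dilate q P) = P.
Proof.
move=> q0; apply/polyP => n.
by rewrite !coef_dilate mulrA -exprMn mulVf // expr1n mul1r.
Qed.

Lemma dilate_prod q (I : Type) (r : seq I) (F : I -> {poly C}) :
  dilate q (\prod_(i <- r) F i) = \prod_(i <- r) dilate q (F i).
Proof. exact: rmorph_prod. Qed.

Lemma dilate_XsubC q a : dilate q ('X - a%:P) = q *: 'X - a%:P.
Proof. by rewrite dilateB /dilate comp_polyX comp_polyC. Qed.

End Dilation.

Section Wronskian.
Variable C : closedFieldType.
Variables q zeta : C.
Implicit Types (a c : C) (P Q E F : {poly C}).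

Definition wronskian P Q : {poly C} :=
  zeta^-1 *: (P * dilate q Q) - zeta *: (dilate q P * Q).

Lemma wronskianDl P P' Q : wronskian (P + P') Q = wronskian P Q + wronskian P' Q.
Proof. by rewrite /wronskian /dilate comp_polyD -!mul_polyC; ring. Qed.

Lemma wronskianBl P P' Q : wronskian (P - P') Q = wronskian P Q - wronskian P' Q.
Proof. by rewrite /wronskian dilateB -!mul_polyC; ring. Qed.

Lemma wronskianZ c d P Q : wronskian (c *: P) (d *: Q) = (c * d) *: wronskian P Q.
Proof. by rewrite /wronskian !dilateZ -!mul_polyC polyCM; ring. Qed.

(** The action of the Wronskian on the quotient E = P / Q, as [wronskianMl]
    shows; on the monomial of degree n it is multiplication by
    zeta^-1 - zeta q^n. *)
Definition qdiff E : {poly C} := zeta^-1 *: E - zeta *: dilate q E.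

Lemma wronskianMl E Q : wronskian (E * Q) Q = qdiff E * (Q * dilate q Q).
Proof. by rewrite /wronskian /qdiff dilateM -!mul_polyC; ring. Qed.

Lemma coef_qdiff E n : (qdiff E)`_n = (zeta^-1 - zeta * q ^+ n) * E`_n.
Proof. by rewrite coefB !coefZ coef_dilate; ring. Qed.

(** This is how nondegeneracy yields coprimality: see [wronskian_coprime]. *)
Lemma root_wronskian P Q a : root Q a -> root P a || root Q (q * a) ->
  root (wronskian P Q) a.
Proof.
rewrite !rootE /wronskian !(hornerD, hornerN, hornerZ, hornerM, horner_dilate) => /eqP ->.
by case/orP => /eqP ->; rewrite !(mul0r, mulr0) subrr.
Qed.

Lemma wronskian_coprime P Q :
  (forall a, root Q a -> ~~ root (wronskian P Q) a) ->
  coprimep P Q /\ coprimep Q (dilate q Q).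
Proof.
move=> H; split.
  rewrite coprimep_sym; apply/Pdiv.ClosedField.coprimepP => a Qa.
  by apply: contra (H a Qa) => Pa; rewrite root_wronskian // rootE Pa.
apply/Pdiv.ClosedField.coprimepP => a Qa; rewrite horner_dilate.
by apply: contra (H a Qa) => Pa; rewrite root_wronskian // orbC rootE Pa.
Qed.

Hypothesis q0 : q != 0.
Hypothesis zeta0 : zeta != 0.
Hypothesis nonres : forall n, zeta ^+ 2 * q ^+ n != 1.

(** A resonance zeta^2 q^n = 1 is exactly a zero eigenvalue of [qdiff]. *)
Lemma qdiff_coef_neq0 n : zeta^-1 - zeta * q ^+ n != 0.
Proof.
apply: contra (nonres n) => /eqP E.
by apply/eqP; transitivity (1 - zeta * (zeta^-1 - zeta * q ^+ n)); [field|rewrite E; ring].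
Qed.

Lemma qdiff_inj0 E : qdiff E = 0 -> E = 0.
Proof.
move=> E0; apply/polyP => n; apply: (mulfI (qdiff_coef_neq0 n)).
by rewrite -coef_qdiff E0 !coef0 mulr0.
Qed.

Lemma qdiff_surj F : exists E, qdiff E = F.
Proof.
exists (\poly_(n < size F) (F`_n / (zeta^-1 - zeta * q ^+ n))).
apply/polyP => n; rewrite coef_qdiff coef_poly; case: ltnP => nF.
  by rewrite mulrC divfK // qdiff_coef_neq0.
by rewrite mulr0 nth_default.
Qed.

(** By linearity take the Wronskian of D and Q to be 0.  Coprimality forces Q to
    divide D, and the quotient is then killed by the injective [qdiff]. *)
Lemma wronskian_injl Q P P' : coprimep Q (dilate q Q) ->
  wronskian P Q = wronskian P' Q -> P = P'.
Proof.
move=> cQ /eqP; rewrite -subr_eq0 -wronskianBl => /eqP W0.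
apply/eqP; rewrite -subr_eq0; apply/eqP; move: (P - P') W0 => {P P'} D W0.
have [Q0|Q0] := eqVneq Q 0.
  by move: cQ; rewrite Q0 /dilate comp_poly0 coprimep0 eqp01.
have : Q %| D.
  rewrite -(Gauss_dvdpl _ cQ).
  have -> : D * dilate q Q = (zeta ^+ 2 *: dilate q D) * Q; last exact: dvdp_mull.
    apply/eqP; rewrite -subr_eq0; apply/eqP.
    transitivity (zeta *: wronskian D Q); last by rewrite W0 scaler0.
    rewrite /wronskian scalerBr !scalerA mulfV // scale1r -!mul_polyC -expr2.
    by ring.
move=> /dvdpP[E DE]; move: W0; rewrite DE wronskianMl => /eqP.
rewrite mulf_eq0 => /orP[/eqP/qdiff_inj0->|]; first by rewrite mul0r.
by rewrite mulf_eq0 dilate_eq0 // orbb (negPf Q0).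
Qed.

(** The obstruction to solving wronskian P Q = F: eliminating P modulo Q between
    the equation and its pullback by z |-> z/q leaves
    zeta F(z) Q(z/q) + zeta^-1 F(z/q) Q(qz) = 0. *)
Definition crossing F Q : {poly C} :=
  zeta *: (F * dilate q^-1 Q) + zeta^-1 *: (dilate q^-1 F * dilate q Q).

Lemma dilateKV P : dilate q (dilate q^-1 P) = P.
Proof. by rewrite -{1}[q]invrK dilateVK // invr_neq0. Qed.

(** Modulo Q, F is zeta^-1 P(z) Q(qz) and F(z/q) is - zeta P(z) Q(z/q), so the
    two terms of the crossing cancel. *)
Lemma dvd_crossing_wronskian P Q : Q %| crossing (wronskian P Q) Q.
Proof.
rewrite /crossing {2}/wronskian dilateB !dilateZ !dilateM !dilateVK //.
rewrite /wronskian.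
have -> : zeta *: ((zeta^-1 *: (P * dilate q Q) - zeta *: (dilate q P * Q)) * dilate q^-1 Q) +
  zeta^-1 *: ((zeta^-1 *: (dilate q^-1 P * Q) - zeta *: (P * dilate q^-1 Q)) * dilate q Q)
  = (zeta^-1 *: (zeta^-1 *: (dilate q^-1 P * dilate q Q)) - zeta *: (zeta *: (dilate q P * dilate q^-1 Q))) * Q.
  by rewrite -!mul_polyC; ring.
exact: dvdp_mull.
Qed.

(** A Bezout relation gives P solving the equation modulo Q; the divisibility of
    the crossing makes it a solution modulo Q(qz) too.  The remaining error is a
    multiple of Q(z) Q(qz), which a correction of P by a multiple of Q absorbs. *)
Lemma wronskian_surj Q F : coprimep Q (dilate q Q) ->
  Q %| crossing F Q -> exists P, wronskian P Q = F.
Proof.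
move=> cQ cross.
have [[u v] /= uv] := Bezout_eq1_coprimepP _ _ cQ.
have [P PE] : exists P, P * dilate q Q = zeta *: (F - F * u * Q).
  by exists (zeta *: (F * v)); rewrite -{2}[F]mulr1 -uv -!mul_polyC; ring.
have dQ : Q %| F - wronskian P Q.
  rewrite /wronskian PE scalerA mulVf // scale1r.
  have -> : F - (F - F * u * Q - zeta *: (dilate q P * Q)) = (F * u + zeta *: dilate q P) * Q.
    by rewrite -!mul_polyC; ring.
  exact: dvdp_mull.
(* pulled back by z |-> z/q and multiplied by Q(qz), which is prime to Q *)
have dqQ : dilate q Q %| F - wronskian P Q.
  suff : Q %| dilate q^-1 (F - wronskian P Q).
    by move=> /dvdpP[S SE]; rewrite -[F - _]dilateKV SE dilateM dvdp_mull.
  rewrite -(Gauss_dvdpl _ cQ) dilateB /wronskian dilateB !dilateZ !dilateM !dilateVK //.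
  have -> : (dilate q^-1 F - (zeta^-1 *: (dilate q^-1 P * Q) - zeta *: (P * dilate q^-1 Q))) * dilate q Q
     = dilate q^-1 F * dilate q Q - zeta^-1 *: (dilate q^-1 P * dilate q Q) * Q
       + zeta *: ((P * dilate q Q) * dilate q^-1 Q).
    by rewrite -!mul_polyC; ring.
  have -> : dilate q^-1 F * dilate q Q - zeta^-1 *: (dilate q^-1 P * dilate q Q) * Q
       + zeta *: ((P * dilate q Q) * dilate q^-1 Q) =
    zeta *: crossing F Q - (zeta^-1 *: (dilate q^-1 P * dilate q Q)
       + zeta ^+ 2 *: (F * u * dilate q^-1 Q)) * Q.
    rewrite PE {1}/crossing [zeta *: (_ + zeta^-1 *: _)]scalerDr.
    rewrite [zeta *: (zeta^-1 *: _)]scalerA mulfV // scale1r.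
    by rewrite -!mul_polyC !polyC_exp; ring.
  by rewrite dvdp_sub ?dvdp_mull // dvdpZr.
have : Q * dilate q Q %| F - wronskian P Q by rewrite Gauss_dvdp // dQ.
move=> /dvdpP[S SE]; have [E EE] := qdiff_surj S.
by exists (P + E * Q); rewrite wronskianDl wronskianMl EE -SE addrC subrK.
Qed.

End Wronskian.

(** * From the quantum Wronskian to the Bethe equations *)

Section RootsPoly.
Variable C : fieldType.
Implicit Types (w : seq C) (x q : C) (F : {poly C}).

Lemma root_roots_poly w x : root (roots_poly w) x = (x \in w).
Proof. exact: root_prod_XsubC. Qed.

Lemma roots_poly_inj w w' : roots_poly w = roots_poly w' -> perm_eq w w'.
Proof.
by move=> E; apply/allP => x _ /=; rewrite -!mu_prod_XsubC -!/(roots_poly _) E.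
Qed.

(** This turns the Bethe equations with multiplicities into one divisibility. *)
Lemma roots_poly_dvdp w F :
  (roots_poly w %| F) <->
  (forall x, x \in w -> ('X - x%:P) ^+ count_mem x w %| F).
Proof.
have [->|F0] := eqVneq F 0; first by split=> *; rewrite dvdp0.
split=> [dF x _|].
  apply: dvdp_trans dF; rewrite -mup_geq ?mu_prod_XsubC //.
  by rewrite monic_neq0 // monic_prod_XsubC.
move=> H; have {H} : forall x, (count_mem x w <= mup x F)%N.
  move=> x; have [xw|xw] := boolP (x \in w); first by rewrite mup_geq // H.
  by rewrite (count_memPn xw).
elim: w F F0 => [|y w IH] F F0 H; first by rewrite /roots_poly big_nil dvd1p.
have : 'X - y%:P %| F.
  by rewrite XsubC_dvd //; apply: leq_trans (H y); rewrite /= eqxx.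
move=> /dvdpP[G FE]; rewrite FE in F0 H *.
have G0 : G != 0 by apply: contraNneq F0 => ->; rewrite mul0r.
rewrite /roots_poly big_cons mulrC dvdp_mul //; apply: IH => // x.
have := H x; rewrite mupM ?polyXsubC_eq0 // -['X - _]expr1 mup_XsubCX /=.
by case: (y == x); rewrite /= ?addn0 ?add0n // add1n addn1 ltnS.
Qed.

End RootsPoly.

Section BethePoly.
Variable C : closedFieldType.
Variables (q zeta : C) (L : nat) (z : 'I_L -> C) (k : 'I_L -> nat).
Hypothesis q0 : q != 0.
Hypothesis zeta0 : zeta != 0.
Variable w : seq C.
Local Notation Q := (roots_poly w).

Let N := \prod_(m < L) ('X - (q ^ (1 - (k m)%:Z) * z m)%:P) : {poly C}.
Let D := \prod_(m < L) ('X - (q * z m)%:P) : {poly C}.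

Lemma dilate_roots_poly : dilate q Q = \prod_(y <- w) (q *: 'X - y%:P).
Proof. by rewrite dilate_prod; apply: eq_bigr => y _; rewrite dilate_XsubC. Qed.

Lemma dilateV_XsubC a : dilate q^-1 ('X - a%:P) = q^-1 *: ('X - (q * a)%:P).
Proof. by rewrite dilate_XsubC scalerBr scale_polyC mulKf. Qed.

Lemma dilateV_roots_poly :
  dilate q^-1 Q = q ^- size w *: \prod_(y <- w) ('X - (q * y)%:P).
Proof.
rewrite dilate_prod -exprVn; elim: w => [|y s IH] /=; first by rewrite !big_nil scale1r.
by rewrite !big_cons IH dilateV_XsubC exprS -!mul_polyC polyCM; ring.
Qed.

(** The string of zeros q^-j z_m, 0 <= j < k_m, and its translate by q differ only
    at their ends; N and D collect these ends.  If k_m = 0 both strings are empty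
    and the two end factors coincide. *)
Lemma rho_dilate :
  rho q z k * D = q ^+ total_weight k *: (dilate q^-1 (rho q z k) * N).
Proof.
rewrite /rho /total_weight /D /N dilate_prod -big_split -big_split /=.
rewrite expr_sum -mul_polyC rmorph_prod -big_split /=.
apply: eq_bigr => m _; rewrite dilate_prod mul_polyC.
elim: (k m) => [|n IH]; first by rewrite !big_ord0 subr0 expr1z scale1r.
rewrite !big_ord_recr /= mulrAC IH dilateV_XsubC.
have -> : q ^ (1 - n.+1%:Z) = q ^- n.
  by rewrite exprnN intS opprD addrA subrr add0r.
have -> : q * (q ^- n * z m) = q ^ (1 - n%:Z) * z m.
  by rewrite expfzDr // expr1z exprnN mulrA.
have qq : q%:P * q^-1%:P = 1 :> {poly C} by rewrite -polyCM mulfV.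
by rewrite -!mul_polyC exprS polyCM; ring: qq.
Qed.

(** Multiplying by D replaces rho(z) by a multiple of rho(z/q), which then factors
    out of both terms of the crossing; what is left is the Bethe polynomial, whose
    coefficient [bethe_coef] absorbs the powers of q and zeta. *)
Lemma crossing_bethe :
  crossing q zeta (rho q z k) Q * D =
  (zeta * q ^ ((total_weight k)%:Z - (size w)%:Z))
    *: (dilate q^-1 (rho q z k) * bethe_poly q zeta z k w).
Proof.
rewrite /crossing /bethe_poly -/N -/D -dilate_roots_poly dilateV_roots_poly.
have -> (A B : {poly C}) : (zeta *: (rho q z k * A) + B) * D =
   zeta *: (rho q z k * D * A) + B * D by rewrite -!mul_polyC; ring.
rewrite rho_dilate mulrDr scalerDr; congr (_ + _).
  rewrite expfzDr // -exprnN -exprnP -!mul_polyC !polyCM.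
  by ring.
rewrite -scalerAr scalerA /bethe_coef.
have -> : zeta * q ^ ((total_weight k)%:Z - (size w)%:Z) *
    (zeta ^- 2 * q ^ ((size w)%:Z - (total_weight k)%:Z)) = zeta^-1.
  by rewrite mulrACA -expfzDr // addrA subrK subrr expr0z mulr1; field.
by rewrite -!mul_polyC; ring.
Qed.

Hypothesis wdisj : forall m x, x \in w -> disjoint_lattices q (z m) x.

Lemma bethe_denom_neq0 x m : x \in w -> x - q * z m != 0.
Proof.
move=> xw; rewrite subr_eq0; apply/eqP => E.
by have := wdisj xw (a := 1%Z) (b := 0%Z); rewrite expr1z expr0z mul1r E => /(_ m).
Qed.

Lemma rho_coprime : forall x, x \in w -> ~~ root (rho q z k) x.
Proof. by move=> x xw; apply: root_rho_disjoint => m; apply: wdisj. Qed.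

(** Nondegeneracy keeps the roots of Q away from the zeros of the extra factors D
    and rho(z/q) of [crossing_bethe]. *)
Lemma crossing_bethe_dvdp :
  (Q %| crossing q zeta (rho q z k) Q) = (Q %| bethe_poly q zeta z k w).
Proof.
have cD : coprimep Q D.
  apply/Pdiv.ClosedField.coprimepP => x; rewrite root_roots_poly => xw.
  rewrite /D horner_prod prodf_seq_neq0; apply/allP => m _ /=.
  by rewrite hornerXsubC bethe_denom_neq0.
have cR : coprimep Q (dilate q^-1 (rho q z k)).
  apply/Pdiv.ClosedField.coprimepP => x; rewrite root_roots_poly => xw.
  rewrite horner_dilate -rootE; apply: root_rho_disjoint => m a b.
  move=> E; have := wdisj xw (m := m) (a := a) (b := b - 1).
  by rewrite expfzDr // -exprnN expr1 -mulrA.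
rewrite -(Gauss_dvdpl _ cD) crossing_bethe dvdpZr ?Gauss_dvdpr //.
by rewrite mulf_neq0 // expfz_neq0.
Qed.

Hypothesis wq : forall x y, x \in w -> y \in w -> x - q * y != 0.

Lemma bethe_poly_root x : x \in w ->
  root (bethe_poly q zeta z k w) x <->
  \prod_(m < L) ((x - q ^ (1 - (k m)%:Z) * z m) / (x - q * z m))
      = - bethe_coef q zeta k w * \prod_(y <- w) ((q * x - y) / (x - q * y)).
Proof.
move=> xw; rewrite !big_split /= !prodfV.
set n := \prod_(m < L) (x - q ^ _ * z m); set d := \prod_(m < L) (x - q * z m).
set a := \prod_(y <- w) (q * x - y); set b := \prod_(y <- w) (x - q * y).
have d0 : d != 0 by apply/prodf_neq0 => m _; apply: bethe_denom_neq0.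
have b0 : b != 0 by rewrite prodf_seq_neq0; apply/allP => y yw; apply: wq.
set c := bethe_coef _ _ _ _.
have E : (bethe_poly q zeta z k w).[x] = d * b * (n / d - - c * (a / b)).
  rewrite /bethe_poly hornerD hornerZ !hornerM !horner_prod.
  under eq_bigr do rewrite hornerXsubC; rewrite -/n.
  under eq_bigr do rewrite hornerXsubC; rewrite -/b.
  under eq_bigr do rewrite hornerD hornerZ hornerX hornerN hornerC; rewrite -/a.
  under eq_bigr do rewrite hornerXsubC; rewrite -/d -/c.
  by field; rewrite d0 b0.
rewrite rootE E mulf_eq0 (negPf (mulf_neq0 d0 b0)) subr_eq0 /=.
by split=> /eqP.
Qed.

End BethePoly.

Section BetheTheorem.
Variable C : closedFieldType.
Variables (q zeta : C) (L : nat) (z : 'I_L -> C) (k : 'I_L -> nat).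
Hypothesis q0 : q != 0.
Hypothesis zeta0 : zeta != 0.
Hypothesis nonres : forall n, zeta ^+ 2 * q ^+ n != 1.
Variable w : seq C.
Hypothesis wdisj : forall m x, x \in w -> disjoint_lattices q (z m) x.

(** The Bethe denominators x - q y are the obstruction to Q being prime to its
    dilate. *)
Lemma bethe_denoms_coprimep :
  (forall x y, x \in w -> y \in w -> x - q * y != 0) <->
  coprimep (roots_poly w) (dilate q (roots_poly w)).
Proof.
split=> [H|/Pdiv.ClosedField.coprimepP H x y xw yw].
  apply/Pdiv.ClosedField.coprimepP => y; rewrite root_roots_poly => yw.
  rewrite horner_dilate -rootE root_roots_poly; apply/negP => xw.
  by have := H _ _ xw yw; rewrite subrr eqxx.
have := H y; rewrite root_roots_poly horner_dilate -rootE root_roots_poly => /(_ yw).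
by apply: contra; rewrite subr_eq0 => /eqP <-.
Qed.

Lemma wronskian_rho_coprimep P :
  wronskian q zeta P (roots_poly w) = rho q z k ->
  coprimep P (roots_poly w) /\ coprimep (roots_poly w) (dilate q (roots_poly w)).
Proof.
move=> PE; apply: (@wronskian_coprime _ q zeta) => x.
by rewrite root_roots_poly PE => /(rho_coprime _ wdisj).
Qed.

(** The Bethe equations with multiplicities say that Q divides the Bethe
    polynomial, hence the crossing of rho and Q, which is the solvability
    criterion for the quantum Wronskian equation. *)
Lemma bethe_wronskian :
  bethe_equations q zeta z k w /\ bethe_multiplicities q zeta z k w <->
  exists P, wronskian q zeta P (roots_poly w) = rho q z k.
Proof.
have dvdE := crossing_bethe_dvdp k q0 zeta0 wdisj.
split=> [[beq bmult]|[P PE]].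
  have wq x y : x \in w -> y \in w -> x - q * y != 0 by move=> /beq[_ H _] /H.
  apply: wronskian_surj => //; first exact/bethe_denoms_coprimep.
  rewrite dvdE; apply/roots_poly_dvdp => x xw.
  have [x1|] := leqP (count_mem x w) 1; last exact: bmult.
  have -> : count_mem x w = 1%N.
    by apply/eqP; rewrite eqn_leq x1 -has_count has_pred1.
  rewrite expr1 dvdp_XsubCl; apply/bethe_poly_root => //.
  by case: (beq x xw).
have [_ /bethe_denoms_coprimep wq] := wronskian_rho_coprimep PE.
have dB : roots_poly w %| bethe_poly q zeta z k w.
  by rewrite -dvdE -PE dvd_crossing_wronskian.
split=> [x xw|x x1]; last first.
  by move/roots_poly_dvdp: dB; apply; rewrite -has_pred1 has_count ltnW.
split=> [m|y yw|].
- exact: (bethe_denom_neq0 wdisj).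
- exact: wq.
by apply/bethe_poly_root => //; rewrite -dvdp_XsubCl (dvdp_trans _ dB) // dvdp_XsubCl root_roots_poly.
Qed.

End BetheTheorem.

(** * Connections gauge equivalent to the twist *)

Section ChangeOfTrivialization.
Variable C : closedFieldType.
Local Notation K := (ratfun C).
Variable q : C.
Hypothesis q0 : q != 0.
Implicit Types (M N : 'M[C]_2) (O : oper_data C) (u v : 'cV[K]_2).

Lemma change_triv_comp M N O : M \in unitmx -> N \in unitmx ->
  change_triv q (constmx M) (change_triv q (constmx N) O)
  = change_triv q (constmx (M *m N)) O.
Proof.
move=> MU NU; rewrite /change_triv /= transportM -constmxM !gauge_constmx //.
have -> : invmx (M *m N) = invmx N *m invmx M by exact: invrM.
by rewrite !constmxM !mulmxA.
Qed.

Lemma change_triv1 O : change_triv q (constmx 1%:M) O = O.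
Proof.
case: O => A V; rewrite /change_triv gauge_constmx //= constmx1 transport1.
by rewrite invmx1 constmx1 mul1mx mulmx1.
Qed.

Lemma wedge_mulmx (g : 'M[K]_2) u v : wedge (g *m u) (g *m v) = \det g * wedge u v.
Proof. by rewrite /wedge -(mul_mx_row g u v); exact: det_mulmx. Qed.

Lemma qpull_section P Q :
  map_mx (qpull q) (section P Q) = section (dilate q P) (dilate q Q).
Proof. by apply/matrixP => i j; rewrite !mxE qpull_poly //; case: ifP. Qed.

Lemma dilate_rowcomb M i P Q :
  dilate q (rowcomb M i P Q) = rowcomb M i (dilate q P) (dilate q Q).
Proof. by rewrite /rowcomb /dilate comp_polyD !comp_polyZ. Qed.

(** A constant change of trivialization multiplies the induced map by its
    determinant, and so preserves the orders of vanishing. *)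
Lemma regular_singularities_change (L : nat) (z : 'I_L -> C) k M O :
  M \in unitmx -> regular_singularities q z k O ->
  regular_singularities q z k (change_triv q (constmx M) O).
Proof.
move=> MU [P [Q [gPQ sing]]]; exists (rowcomb M 0 P Q), (rowcomb M 1 P Q).
split; first exact: generates_transport.
rewrite /= qpull_section !dilate_rowcomb -!constmx_section.
have cancel_conj (g h A : 'M[K]_2) (s : 'cV[K]_2) : h *m g = 1%:M ->
    g *m A *m h *m (g *m s) = g *m (A *m s).
  by move=> hg; rewrite mulmxA -(mulmxA _ h g) hg mulmx1 mulmxA.
have VM : constmx (invmx M) *m constmx M = 1%:M by rewrite -constmxM mulVmx // constmx1.
rewrite (gauge_constmx _ _ q0).
rewrite (cancel_conj _ _ _ _ VM).
rewrite wedge_mulmx.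
rewrite det_constmx.
apply: (has_singularitiesZ (z := z) (k := k)); first by rewrite -unitfE -unitmxE.
by move: sing; rewrite /= qpull_section.
Qed.

End ChangeOfTrivialization.

Section Twist.
Variable C : closedFieldType.
Local Notation K := (ratfun C).
Variables (q zeta : C).
Hypothesis q0 : q != 0.
Hypothesis zeta0 : zeta != 0.
Implicit Types (M N : 'M[C]_2) (O : oper_data C).
Implicit Types (P Q : {poly C}) (V : {vspace 'cV[K]_2}).

Definition diag2 (a b : C) : 'M[C]_2 := diag_mx (\row_i (if i == 0 then a else b)).

Lemma diag2M a b c d : diag2 a b *m diag2 c d = diag2 (a * c) (b * d).
Proof.
rewrite /diag2 mulmx_diag; congr diag_mx.
by apply/rowP => i; rewrite !mxE; case: ifP.
Qed.

Lemma diag2_unit a b : a != 0 -> b != 0 -> diag2 a b \in unitmx.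
Proof.
move=> a0 b0; rewrite unitmxE det_diag unitfE.
by apply/prodf_neq0 => i _; rewrite mxE; case: ifP.
Qed.

Lemma inv_twist : invmx (twist zeta) = diag2 zeta^-1 zeta.
Proof.
have tU : twist zeta \in unitmx by apply: diag2_unit; rewrite ?invr_eq0.
rewrite -[RHS]mul1mx -(mulVmx tU) -mulmxA diag2M mulfV // mulVf //.
rewrite (_ : diag2 1 1 = 1%:M) ?mulmx1 //.
by apply/matrixP => i j; rewrite !mxE if_same.
Qed.

Lemma rowcomb_diag2 a b P Q :
  (rowcomb (diag2 a b) 0 P Q = a *: P) * (rowcomb (diag2 a b) 1 P Q = b *: Q).
Proof.
by split; rewrite /rowcomb !mxE /= ?mulr1n ?mulr0n scale0r ?addr0 ?add0r.
Qed.

(** The eigenvalues zeta and zeta^-1 of the twist are distinct. *)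
Lemma commute_twist M : zeta ^+ 2 != 1 ->
  M *m invmx (twist zeta) = invmx (twist zeta) *m M -> M = diag2 (M 0 0) (M 1 1).
Proof.
move=> zeta2; rewrite inv_twist => /matrixP E.
have zz : zeta - zeta^-1 != 0.
  apply: contra zeta2; rewrite subr_eq0 expr2 => /eqP {2}->.
  by rewrite mulfV.
have l1 : lift 0 0 = 1 :> 'I_2 by exact/val_inj.
have M01 : M 0 1 = 0.
  apply: (mulfI zz); have := E 0 1.
  rewrite !mxE !big_ord_recl !big_ord0 !mxE !l1 /= !(mulr1n, mulr0n) => E01.
  by rewrite mulr0 mulrBl; move: E01; rewrite !(mul0r, mulr0, addr0, add0r) mulrC => ->; rewrite subrr.
have M10 : M 1 0 = 0.
  apply: (mulfI zz); have := E 1 0.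
  rewrite !mxE !big_ord_recl !big_ord0 !mxE !l1 /= !(mulr1n, mulr0n) => E01.
  by rewrite mulr0 mulrBl; move: E01; rewrite !(mul0r, mulr0, addr0, add0r) mulrC => ->; rewrite subrr.
apply/matrixP => i j; rewrite !mxE.
case: (unliftP 0 i) => [i' ->|->]; case: (unliftP 0 j) => [j' ->|->];
  by rewrite ?ord1 ?l1 /= ?mulr1n ?mulr0n.
Qed.

Lemma trivializes_to_twistP O g : trivializes_to_twist q zeta O g <->
  exists2 M, M \in unitmx & g = constmx M /\
    change_triv q (constmx M) O
    = OperData (constmx (invmx (twist zeta))) (transport g (line O)).
Proof.
split=> [[/triv_changeP[M MU ->] gE]|[M MU [-> [gE]]]].
  by exists M => //; split=> //; rewrite /change_triv gE.
by split=> //; apply/triv_changeP; exists M.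
Qed.

Lemma trivializes_to_twist_mul O M N : M \in unitmx -> N \in unitmx ->
  trivializes_to_twist q zeta O (constmx (M *m N)) <->
  trivializes_to_twist q zeta (change_triv q (constmx N) O) (constmx M).
Proof.
move=> MU NU.
have E : gauge q (constmx M) (conn (change_triv q (constmx N) O)) =
   gauge q (constmx (M *m N)) (conn O).
  exact (congr1 (@conn C) (change_triv_comp q0 O MU NU)).
rewrite /trivializes_to_twist E; split=> -[_ gE]; (split; last exact: gE); apply/triv_changeP.
  by exists M.
by exists (M *m N); first by rewrite unitmx_mul MU.
Qed.

Lemma gauge_twist_diag2 a b : a != 0 -> b != 0 ->
  gauge q (constmx (diag2 a b)) (constmx (invmx (twist zeta)))
  = constmx (invmx (twist zeta)).
Proof.
move=> a0 b0; rewrite gauge_constmx // -!constmxM; congr constmx.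
rewrite inv_twist diag2M [a * _]mulrC [b * _]mulrC -diag2M.
by rewrite -mulmxA mulmxV ?mulmx1 // diag2_unit.
Qed.

(** The two trivializations differ by a constant matrix commuting with the
    twist, hence diagonal. *)
Lemma twisted_section_unique O g g' P Q P' Q' : zeta ^+ 2 != 1 ->
  trivializes_to_twist q zeta O g -> trivializes_to_twist q zeta O g' ->
  generates P Q (transport g (line O)) ->
  generates P' Q' (transport g' (line O)) ->
  exists c d, [/\ c != 0, d != 0, P' = c *: P & Q' = d *: Q].
Proof.
move=> zeta2 /trivializes_to_twistP[M MU [-> OE]].
move=> /trivializes_to_twistP[M' MU' [-> OE']] gPQ gPQ'.
have [N NU NE] : exists2 N, N \in unitmx & N *m M = M'.
  by exists (M' *m invmx M); rewrite ?mulmxKV // unitmx_mul MU' unitmx_inv.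
have := change_triv_comp q0 O NU MU; rewrite NE OE OE'.
rewrite /change_triv /= gauge_constmx // => -[].
rewrite -!constmxM => /constmx_inj NT VE.
have NC : N = diag2 (N 0 0) (N 1 1).
  by apply: commute_twist => //; rewrite -[in RHS]NT mulmxKV.
have := generates_transport NU gPQ; rewrite VE NC !rowcomb_diag2 => gPQ2.
have [c [c0 -> ->]] := generates_unique gPQ2 gPQ'.
have : \det N != 0 by rewrite -unitfE -unitmxE.
rewrite NC det2E !mxE /= !(mulr1n, mulr0n) mul0r subr0 mulf_eq0 negb_or.
move=> /andP[n0 n1]; exists (c * N 0 0), (c * N 1 1).
rewrite !scalerA; split=> //; exact: mulf_neq0.
Qed.

Lemma wedge_twist P Q :
  wedge (map_mx (qpull q) (section P Q)) (constmx (invmx (twist zeta)) *m section P Q)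
  = (- wronskian q zeta P Q)%:F.
Proof.
rewrite qpull_section // constmx_section inv_twist !rowcomb_diag2 wedgeE.
rewrite !section_entries -!tofracM -tofracB /wronskian; congr (_ %:F).
by rewrite -!mul_polyC; ring.
Qed.

Variables (L : nat) (z : 'I_L -> C) (k : 'I_L -> nat).
Hypothesis qn1 : forall n : nat, (0 < n)%N -> q ^+ n != 1.
Hypothesis z0 : forall m, z m != 0.
Hypothesis zdisj : forall m n, m != n -> disjoint_lattices q (z m) (z n).

Lemma regular_singularities_twist V :
  regular_singularities q z k (OperData (constmx (invmx (twist zeta))) V) <->
  exists P Q c, [/\ generates P Q V, c != 0 & wronskian q zeta P Q = c *: rho q z k].
Proof.
have E P Q : has_singularities q z k (- wronskian q zeta P Q)%:F <->
   exists2 c, c != 0 & wronskian q zeta P Q = c *: rho q z k.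
  rewrite has_singularities_rho //; split=> -[c c0 WE]; exists (- c).
  - by rewrite oppr_eq0.
  - by rewrite scaleNr -WE opprK.
  - by rewrite oppr_eq0.
  - by rewrite scaleNr -WE.
split=> [[P [Q [gPQ]]]|[P [Q [c [gPQ c0 WE]]]]].
  by rewrite /= wedge_twist => /E[c c0 WE]; exists P, Q, c.
by exists P, Q; split => //; rewrite /= wedge_twist; apply/E; exists c.
Qed.

End Twist.

(** * The correspondence *)

Section Correspondence.
Variable C : closedFieldType.
Local Notation K := (ratfun C).
Variables (q zeta : C) (L : nat) (z : 'I_L -> C) (k : 'I_L -> nat).
Hypothesis q0 : q != 0.
Hypothesis qn1 : forall n : nat, (0 < n)%N -> q ^+ n != 1.
Hypothesis z0 : forall m, z m != 0.
Hypothesis zdisj : forall m n, m != n -> disjoint_lattices q (z m) (z n).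
Hypothesis zeta0 : zeta != 0.
Hypothesis nonres : forall n : nat, zeta ^+ 2 * q ^+ n != 1.
Implicit Types (w : seq C) (O : oper_data C).

Let zeta2 : zeta ^+ 2 != 1.
Proof. by have := nonres 0; rewrite mulr1. Qed.

Local Notation Zinv := (constmx (invmx (twist zeta))).

Lemma trivializes_to_twist_id V :
  trivializes_to_twist q zeta (OperData Zinv V) (constmx 1%:M).
Proof.
split; first by apply/triv_changeP; exists 1%:M; rewrite ?unitmx1.
exact (congr1 (@conn C) (change_triv1 q0 (OperData Zinv V))).
Qed.

(** Take the connection Z^-1 on the trivial bundle, and the line spanned by
    (Q+, Q-), where Q- has the roots w and Q+ solves the quantum Wronskian
    equation. *)
Lemma oper_of_bethe_solution w : nondegenerate_bethe_solution q zeta z k w ->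
  exists2 O, nondegenerate_twisted_oper q zeta z k O & corresponds q zeta z k O w.
Proof.
move=> [beq bmult wdisj].
have [P PE] := (bethe_wronskian k q0 zeta0 nonres wdisj).1 (conj beq bmult).
have [cPQ _] := wronskian_rho_coprimep wdisj PE.
pose V := <[section P (roots_poly w)]>%VS; pose O := OperData Zinv V.
have triv := trivializes_to_twist_id V.
have gV : generates P (roots_poly w) V by [].
have gV1 : generates P (roots_poly w) (transport (constmx 1%:M) (line O)).
  by rewrite constmx1 transport1.
exists O; last by exists (constmx 1%:M), P.
split; last 2 first.
- by exists (constmx 1%:M).
- move=> g P' Q' triv' gV' m a.
  have [c [d [_ d0 _ ->]]] := twisted_section_unique q0 zeta0 zeta2 triv triv' gV1 gV'.
  by rewrite rootZ // root_roots_poly; apply: wdisj.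
have tU : twist zeta \in unitmx by apply: diag2_unit; rewrite ?invr_eq0.
split; first split.
- by rewrite constmx_unit unitmx_inv.
- exists (constmx 1%:M); first by case: triv.
  by rewrite (proj2 triv) det_constmx inv_twist // det_diag !big_ord_recl big_ord0 !mxE /= mulr1 mulVf.
- by rewrite dim_vline section_neq0.
apply/regular_singularities_twist => //; exists P, (roots_poly w), 1.
by rewrite scale1r oner_neq0.
Qed.

(** In a twisting trivialization the Wronskian of the generating pair is c rho;
    a diagonal change of trivialization makes Q- monic and c equal to 1. *)
Lemma bethe_solution_of_oper O : nondegenerate_twisted_oper q zeta z k O ->
  exists2 w, nondegenerate_bethe_solution q zeta z k w & corresponds q zeta z k O w.
Proof.
move=> [[_ _ sing] [g triv] nondeg].
have /trivializes_to_twistP[M MU [gE OE]] := triv.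
have := regular_singularities_change q0 MU sing; rewrite OE.
move=> /(regular_singularities_twist q0 zeta0 k qn1 z0 zdisj).
move=> [P [Q [c [gPQ c0 WE]]]].
have Q0 : Q != 0.
  apply/eqP => QE; move/eqP: WE; rewrite QE /wronskian /dilate comp_poly0 !mulr0 !scaler0.
  by rewrite subrr eq_sym scaler_eq0 (negPf c0) (negPf (rho_neq0 _ _ _)).
have [w QE] := closed_field_poly_normal Q.
set d := lead_coef Q in QE; have d0 : d != 0 by rewrite lead_coef_eq0.
have rE : roots_poly w = d^-1 *: Q by rewrite QE scalerA mulVf // scale1r.
(* d^-1 makes Q monic; d / c then makes the total factor (d / c) d^-1 c equal to 1 *)
have dc0 : d / c != 0 by rewrite mulf_neq0 // invr_eq0.
have dV0 : d^-1 != 0 by rewrite invr_eq0.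
pose N := diag2 (d / c) d^-1; have NU : N \in unitmx by exact: diag2_unit.
have triv' : trivializes_to_twist q zeta O (constmx (N *m M)).
  apply/(trivializes_to_twist_mul zeta q0 O NU MU); rewrite OE; split.
    by apply/triv_changeP; exists N.
  exact: gauge_twist_diag2.
have gV : generates ((d / c) *: P) (roots_poly w) (transport (constmx (N *m M)) (line O)).
  rewrite constmxM -transportM -gE.
  have := generates_transport NU gPQ; rewrite !rowcomb_diag2.
  by rewrite -rE.
have WE' : wronskian q zeta ((d / c) *: P) (roots_poly w) = rho q z k.
  rewrite rE wronskianZ WE scalerA.
  by rewrite (_ : _ * c = 1) ?scale1r //; field; rewrite c0 d0.
have wdisj m x : x \in w -> disjoint_lattices q (z m) x.
  by rewrite -root_roots_poly => /(nondeg _ _ _ triv' gV m).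
exists w; last by exists (constmx (N *m M)), ((d / c) *: P).
have [beq bmult] := (bethe_wronskian k q0 zeta0 nonres wdisj).2 (ex_intro _ _ WE').
by [].
Qed.

(** Equal roots give equal Q-, then equal Q+ by [wronskian_injl], hence the same
    line in the two twisting trivializations.  Conversely an isomorphism carries one
    twisting trivialization to another, so the two Q- are proportional, and both are
    monic. *)
Lemma corresponds_iso w w' O O' :
  nondegenerate_bethe_solution q zeta z k w ->
  corresponds q zeta z k O w -> corresponds q zeta z k O' w' ->
  perm_eq w w' <-> oper_iso q O O'.
Proof.
move=> [_ _ wdisj] [g [P [triv gP WE]]] [g' [P' [triv' gP' WE']]].
split=> [ww'|[h /triv_changeP[N NU ->] OE]].
  have QE : roots_poly w' = roots_poly w by apply: perm_big; rewrite perm_sym.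
  rewrite QE in gP' WE'.
  have [_ cQ] := wronskian_rho_coprimep wdisj WE.
  have PE : P' = P.
    by apply: (wronskian_injl q0 zeta0 nonres cQ); rewrite /wronskian WE WE'.
  have /trivializes_to_twistP[M MU [gE OE]] := triv.
  have /trivializes_to_twistP[M' MU' [gE' OE']] := triv'.
  have VE : transport g' (line O') = transport g (line O).
    by rewrite (proj2 gP') (proj2 gP) PE.
  have MVU' : invmx M' \in unitmx by rewrite unitmx_inv.
  exists (constmx (invmx M' *m M)).
    by apply/triv_changeP; exists (invmx M' *m M); rewrite // unitmx_mul MVU'.
  rewrite -(change_triv_comp q0 O MVU' MU) OE -VE -OE'.
  by rewrite (change_triv_comp q0 O' MVU' MU') mulVmx // change_triv1.
rewrite OE in triv' gP'.
have /triv_changeP[M' MU' gE'] := proj1 triv'.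
have triv2 : trivializes_to_twist q zeta O (constmx (M' *m N)).
  by apply/trivializes_to_twist_mul; rewrite -?gE'.
have gP2 : generates P' (roots_poly w') (transport (constmx (M' *m N)) (line O)).
  by rewrite constmxM -gE' -transportM.
have [c [d [_ d0 _ QE]]] := twisted_section_unique q0 zeta0 zeta2 triv triv2 gP gP2.
apply: roots_poly_inj.
have := congr1 lead_coef QE; rewrite lead_coefZ !(monicP (monic_prod_XsubC _ _ _)).
by rewrite QE mulr1 => <-; rewrite scale1r.
Qed.

End Correspondence.

Theorem theorem3p6 (R : realType) (q zeta : R[i]) (L : nat)
    (z : 'I_L -> R[i]) (k : 'I_L -> nat)
    (hq0 : q != 0) (hq : forall n : nat, (0 < n)%N -> q ^+ n != 1)
    (hz : forall m, z m != 0)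
    (hlat : forall m n, m != n -> disjoint_lattices q (z m) (z n))
    (hzeta0 : zeta != 0) (hzeta1 : zeta != 1) (hzetaN1 : zeta != -1)
    (hres : forall n : nat, (0 < n)%N -> zeta ^+ 2 * q ^+ n != 1) :
  one_to_one_correspondence
    (fun w : seq R[i] => nondegenerate_bethe_solution q zeta z k w)
    (fun w w' => perm_eq w w')
    (fun O : oper_data R[i] => nondegenerate_twisted_oper q zeta z k O)
    (fun O O' => oper_iso q O O')
    (fun w O => corresponds q zeta z k O w).
Proof.
have nonres n : zeta ^+ 2 * q ^+ n != 1.
  case: n => [|n]; last exact: hres.
  by rewrite mulr1 sqrf_eq1 negb_or hzeta1.
split.
- exact: oper_of_bethe_solution.
- exact: bethe_solution_of_oper.
- move=> w w' O O' Pw _ _ _; exact: corresponds_iso.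
Qed.
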